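(* For any lattice $\mathcal{L} \subset \mathbb{R}^n$, vector $\mathbf{x} \in \mathbb{R}^n$, and $s>0$, \[ \frac{\frac{d}{ds} f_{\mathcal{L}, s}(\mathbf{x})}{f_{\mathcal{L}, s}(\mathbf{x})}\geq \frac{s}{2\pi} \cdot \frac{\|\nabla f_{\mathcal{L}, s}(\mathbf{x})\|^2}{f_{\mathcal{L}, s}(\mathbf{x})^2} , \] where $\nabla$ denotes the gradient with respect to $\mathbf{x}$.
   Context: A lattice $\mathcal{L}\subset\mathbb{R}^n$ is the set of all integer linear combinations of $n$ linearly independent vectors of $\mathbb{R}^n$. For $s>0$ and $\mathbf{x}\in\mathbb{R}^n$, $\rho_s(\mathbf{x}) = \exp(-\pi \|\mathbf{x}\|^2/s^2)$ with $\|\cdot\|$ the Euclidean norm, and for a discrete set $A\subset\mathbb{R}^n$, $\rho_s(A) = \sum_{\mathbf{w}\in A}\rho_s(\mathbf{w})$. The periodic Gaussian function with parameter $s$ is $f_{\mathcal{L},s}(\mathbf{x}) = \rho_s(\mathcal{L}+\mathbf{x})/\rho_s(\mathcal{L})$. *)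

(* Defs.v *)
From mathcomp Require Import all_boot all_order all_algebra.
From mathcomp Require Import all_classical all_reals all_analysis.

Set Implicit Arguments.
Unset Strict Implicit.
Unset Printing Implicit Defensive.

Import Order.TTheory GRing.Theory Num.Theory.
Import numFieldNormedType.Exports.

Local Open Scope classical_set_scope.
Local Open Scope ring_scope.

(* The library's norm `|x| on 'rV[R]_n is the sup norm, hence this one. *)
Definition enorm (R : realType) (n : nat) (x : 'rV[R]_n) : R :=
  Num.sqrt (\sum_(i < n) x ord0 i ^+ 2).

Definition is_lattice (R : realType) (n : nat) (L : set 'rV[R]_n) : Prop :=
  exists2 b : n.-tuple 'rV[R]_n, free b &
    L = [set \sum_(i < n) tnth b i *~ z i | z in [set: 'I_n -> int]].

Definition translate (R : realType) (n : nat) (A : set 'rV[R]_n)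
    (x : 'rV[R]_n) : set 'rV[R]_n :=
  [set w + x | w in A].

Definition rho (R : realType) (n : nat) (s : R) (x : 'rV[R]_n) : R :=
  expR (- pi * enorm x ^+ 2 / s ^+ 2).

(* The terms are positive, so the sum over A is the unconditional sum
   \esum in \bar R; it is finite when A is a translate of a lattice, and
   fine then returns its value. *)
Definition rho_set (R : realType) (n : nat) (s : R) (A : set 'rV[R]_n) : R :=
  fine (\esum_(w in A) (rho s w)%:E).

Definition periodic_gaussian (R : realType) (n : nat) (L : set 'rV[R]_n)
    (s : R) (x : 'rV[R]_n) : R :=
  rho_set s (translate L x) / rho_set s L.

(* As 'D_v is a total operator, this is the gradient of g at x only where g is
   differentiable. *)
Definition gradient (R : realType) (n : nat) (g : 'rV[R]_n -> R)
    (x : 'rV[R]_n) : 'rV[R]_n :=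
  \row_(i < n) 'D_(delta_mx ord0 i) g x.

(* Main.v *)
From HB Require Import structures.
Require Import Defs.
From mathcomp Require Import all_boot all_order all_algebra finmap.
From mathcomp Require Import all_classical all_reals all_analysis.
From mathcomp Require Import zify ring lra.
Set Implicit Arguments.
Unset Strict Implicit.
Unset Printing Implicit Defensive.
Import Order.TTheory GRing.Theory Num.Theory.
Import numFieldNormedType.Exports.
Local Open Scope classical_set_scope.
Local Open Scope ring_scope.

(* Write A_0(y), A_1(y), A_2(y) for the total weight and the first and second
   moments of the Gaussian weights on L + y, and A_{k,i} for coordinate i.
   Differentiating the sums term by term turns the claim into: for every
   coordinate i, the variance A_{2,i}/A_0 - (A_{1,i}/A_0)^2 at x is at least
   its value A_{2,i}(0)/A_0(0) at 0.

   For (w, w') in (L + x) x L put p = w + w' and q = w - w'. The pair (p, q)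
   ranges over all pairs in (L + x)^2 that are congruent modulo 2L, and
   rho_s(w) rho_s(w') = rho_{sqrt 2 s}(p) rho_{sqrt 2 s}(q). Hence, for every a,
     sum_{w, w'} (a + p_i) (a + q_i) rho_s(w) rho_s(w')
       = sum over the cosets C of 2L in L + x of
           (sum_{p in C} (a + p_i) rho_{sqrt 2 s}(p))^2 >= 0.
   As p_i + q_i = 2 w_i and p_i q_i = w_i^2 - w'_i^2, the left side is
     (a^2 A_0(x) + 2 a A_{1,i}(x) + A_{2,i}(x)) A_0(0) - A_0(x) A_{2,i}(0),
   and a = - A_{1,i}(x) / A_0(x) gives the inequality of variances. *)

(** * Unconditional sums of signed families *)

Section HasSum.
Context {R : realType}.

Lemma esumZl (T : choiceType) (a : T -> \bar R) (r : R) : 0 <= r ->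
  (forall i, 0 <= a i)%E ->
  (\esum_(i in [set: T]) (r%:E * a i) = r%:E * \esum_(i in [set: T]) a i)%E.
Proof.
move=> r0 a0; rewrite /esum -ereal_supZl//; last first.
  apply/set0P; exists (\sum_(x \in set0) a x)%E.
  by exists set0 => //; exact: fsets_set0.
rewrite image_comp; congr ereal_sup; apply: eq_imagel => A _ /=.
by rewrite ge0_mule_fsumr.
Qed.

(* Unconditional summability of a signed family, as a difference of two
   nonnegative families with finite [\esum]. *)
Definition has_sum (T : choiceType) (f : T -> R) (l : R) :=
  exists u v U V, [/\ forall i, 0 <= u i, forall i, 0 <= v i,
    \esum_(i in [set: T]) (u i)%:E = U%:E,
    \esum_(i in [set: T]) (v i)%:E = V%:E &
    (forall i, f i = u i - v i) /\ l = U - V].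

Section OneType.
Context {T : choiceType}.
Implicit Types (f g : T -> R).

(** Since [f + v = u] pointwise, additivity of [\esum] gives an equation in which the finite total
    [V] can be cancelled. *)
Lemma has_sum_nneg f l : (forall i, 0 <= f i) -> has_sum f l ->
  \esum_(i in [set: T]) (f i)%:E = l%:E.
Proof.
move=> f0 [u [v [U [V [u0 v0 eU eV [fuv ->]]]]]].
have := @esumD R T setT (EFin \o f) (EFin \o v).
move=> /(_ (fun i _ => f0 i) (fun i _ => v0 i)).
rewrite [X in X = _](_ : _ = U%:E); last first.
  by rewrite -eU; apply: eq_esum => i _ /=; rewrite fuv -EFinD subrK.
rewrite [in X in _ = (_ + X)%E]/comp eV => /esym e.
have : (\esum_(i in [set: T]) (f i)%:E + V%:E)%E = U%:E by exact: e.
case: (\esum_(i in _) _) => [r| |] //=.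
by rewrite -EFinD => -[<-]; rewrite addrK.
Qed.

Lemma esum_has_sum f l : (forall i, 0 <= f i) ->
  \esum_(i in [set: T]) (f i)%:E = l%:E -> has_sum f l.
Proof.
move=> f0 fl; exists f, (fun=> 0), l, 0; split => //.
- by apply: esum1.
- by split => [i|]; rewrite subr0.
Qed.

Lemma has_sum0 : has_sum (fun _ : T => 0) 0.
Proof. by apply: esum_has_sum => //; exact: esum1. Qed.

Lemma has_sumD f g k l :
  has_sum f k -> has_sum g l -> has_sum (fun i => f i + g i) (k + l).
Proof.
move=> [u [v [U [V [u0 v0 eU eV [fuv ->]]]]]].
move=> [u' [v' [U' [V' [u0' v0' eU' eV' [fuv' ->]]]]]].
exists (fun i => u i + u' i), (fun i => v i + v' i), (U + U'), (V + V'); split.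
- by move=> i; rewrite addr_ge0.
- by move=> i; rewrite addr_ge0.
- under eq_esum do rewrite EFinD.
  by rewrite esumD ?eU ?eU'// => i _; rewrite lee_fin.
- under eq_esum do rewrite EFinD.
  by rewrite esumD ?eV ?eV'// => i _; rewrite lee_fin.
- by split=> [i|]; rewrite ?fuv ?fuv'; ring.
Qed.

Lemma eq_has_sum f g l : f =1 g -> has_sum f l -> has_sum g l.
Proof. by move=> /funext ->. Qed.

Lemma has_sumN f l : has_sum f l -> has_sum (fun i => - f i) (- l).
Proof.
move=> [u [v [U [V [u0 v0 eU eV [fuv ->]]]]]].
by exists v, u, V, U; split=> //; split=> [i|]; rewrite ?fuv opprB.
Qed.

(** Subtracting the two sums represents the zero family, to which [has_sum_nneg] applies. *)
Lemma has_sum_unique f k l : has_sum f k -> has_sum f l -> k = l.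
Proof.
move=> fk /has_sumN fl; have := has_sumD fk fl.
move=> /(eq_has_sum (g := fun=> 0)) => /(_ (fun i => subrr _)).
move=> /(has_sum_nneg (fun=> lexx 0)); rewrite esum1// => -[] /esym/eqP.
by rewrite subr_eq0 => /eqP.
Qed.

Lemma has_sum_ge0 f l : (forall i, 0 <= f i) -> has_sum f l -> 0 <= l.
Proof.
move=> f0 /(has_sum_nneg f0) fl; rewrite -lee_fin -fl.
by apply: esum_ge0 => i _; rewrite lee_fin.
Qed.

Lemma has_sum_le f g k l : (forall i, f i <= g i) ->
  has_sum f k -> has_sum g l -> k <= l.
Proof.
move=> fg /has_sumN fk gl; rewrite -subr_ge0.
by apply: has_sum_ge0 (has_sumD gl fk) => i; rewrite subr_ge0.
Qed.

(** Comparison test: the positive and negative parts of [f] lie between 0 and [g], so their [\esum]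
    is finite. *)
Lemma has_sum_dominated f g l : (forall i, `|f i| <= g i) -> has_sum g l ->
  exists k, has_sum f k.
Proof.
move=> fg gl.
have g0 i : 0 <= g i by apply: le_trans (fg i).
have bounded h : (forall i, 0 <= h i <= g i) -> exists k, has_sum h k.
  move=> hg; exists (fine (\esum_(i in [set: T]) (h i)%:E)).
  apply: esum_has_sum => [i|]; first by have /andP[] := hg i.
  rewrite fineK//; apply/fin_numPlt/andP; split.
    apply: lt_le_trans (ltNyr 0) (esum_ge0 _) => i _.
    by rewrite lee_fin; have /andP[] := hg i.
  apply: le_lt_trans (ltry l); rewrite -(has_sum_nneg g0 gl).
  by apply: le_esum => i _; rewrite lee_fin; have /andP[] := hg i.
have [k fk] : exists k, has_sum (fun i => Num.max (f i) 0) k.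
  apply: bounded => i; rewrite le_max lexx orbT ge_max g0 andbT.
  exact: le_trans (ler_norm _) (fg i).
have [k' fk'] : exists k, has_sum (fun i => Num.max (- f i) 0) k.
  apply: bounded => i; rewrite le_max lexx orbT ge_max g0 andbT.
  by apply: le_trans (fg i); rewrite -normrN ler_norm.
exists (k - k'); apply: eq_has_sum (has_sumD fk (has_sumN fk')) => i /=.
by rewrite /Num.max; case: ltP => ?; case: ltP => ?; lra.
Qed.

(** Canonical representation: unlike arbitrary [u] and [v], these parts vanish wherever [f] does,
    which reindexing along an injection relies on. *)
Lemma has_sum_parts f l : has_sum f l -> exists k k',
  [/\ has_sum (fun i => Num.max (f i) 0) k,
      has_sum (fun i => Num.max (- f i) 0) k' & l = k - k'].
Proof.
move=> /[dup] fl [u [v [U [V [u0 v0 eU eV [fuv _]]]]]].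
have uv := has_sumD (esum_has_sum u0 eU) (esum_has_sum v0 eV).
have [|k fk] := has_sum_dominated (f := fun i => Num.max (f i) 0) _ uv.
  move=> i; have := u0 i; have := v0 i; rewrite fuv => ? ?.
  by rewrite /Num.max; case: ltP => ?; rewrite ler_norml; lra.
have [|k' fk'] := has_sum_dominated (f := fun i => Num.max (- f i) 0) _ uv.
  move=> i; have := u0 i; have := v0 i; rewrite fuv => ? ?.
  by rewrite /Num.max; case: ltP => ?; rewrite ler_norml; lra.
exists k, k'; split => //; apply: has_sum_unique fl _.
apply: eq_has_sum (has_sumD fk (has_sumN fk')) => i /=.
by rewrite /Num.max; case: ltP => ?; case: ltP => ?; lra.
Qed.

End OneType.

(** Tonelli for nonnegative families; expanding [(u - v) * (u' - v')] into four such products gives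
    the signed case. *)
Lemma has_sum_mul (S T : choiceType) (f : S -> R) (g : T -> R) k l :
  has_sum f k -> has_sum g l -> has_sum (fun p => f p.1 * g p.2) (k * l).
Proof.
have nneg (a : S -> R) (b : T -> R) A B :
    (forall i, 0 <= a i) -> (forall i, 0 <= b i) ->
    \esum_(i in [set: S]) (a i)%:E = A%:E ->
    \esum_(i in [set: T]) (b i)%:E = B%:E ->
    has_sum (fun p => a p.1 * b p.2) (A * B).
  move=> a0 b0 eA eB; apply: esum_has_sum => [p|]; first exact: mulr_ge0.
  have := @esum_esum R S T setT (fun=> setT) (fun i j => (a i * b j)%:E).
  rewrite [X in _ = esum X _](_ : _ = setT); last by apply/seteqP; split.
  move=> <- => [|i j _ _]; last by rewrite lee_fin mulr_ge0.
  transitivity (\esum_(i in [set: S]) (B%:E * (a i)%:E)%E).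
    apply: eq_esum => i _; under eq_esum do rewrite EFinM.
    by rewrite esumZl// ?eB 1?muleC// => j; rewrite lee_fin.
  rewrite esumZl ?eA 1?muleC//.
  by rewrite -lee_fin -eB; apply: esum_ge0 => i _; rewrite lee_fin.
move=> [u [v [U [V [u0 v0 eU eV [fuv ->]]]]]].
move=> [u' [v' [U' [V' [u0' v0' eU' eV' [fuv' ->]]]]]].
have p1 := nneg _ _ _ _ u0 u0' eU eU'.
have p2 := nneg _ _ _ _ v0 v0' eV eV'.
have p3 := nneg _ _ _ _ u0 v0' eU eV'.
have p4 := nneg _ _ _ _ v0 u0' eV eU'.
have -> : (U - V) * (U' - V') = (U * U' + V * V') + - (U * V' + V * U') by ring.
apply: eq_has_sum (has_sumD (has_sumD p1 p2) (has_sumN (has_sumD p3 p4))) => p.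
by rewrite fuv fuv'; ring.
Qed.

(** The extension of [f] by zero has positive and negative parts supported on [P], and
    [reindex_esum] transports each of them. *)
Lemma has_sum_reindex (S T : choiceType) (e : S -> T) (P : set T) (f : T -> R) l :
  injective e -> range e = P -> has_sum (fun i => if i \in P then f i else 0) l ->
  has_sum (f \o e) l.
Proof.
move=> ei eP fl.
have nneg (a : T -> R) A : (forall i, 0 <= a i) ->
    \esum_(i in [set: T]) (a i)%:E = A%:E -> (forall i, ~ P i -> a i = 0) ->
    \esum_(i in [set: S]) (a (e i))%:E = A%:E.
  move=> a0 eA aP; rewrite -(reindex_esum setT P e (EFin \o a)).
    rewrite esum_mkcond -eA; apply: eq_esum => i _.
    case: ifPn => // /negP; rewrite inE => /aP ->//.
  by rewrite -eP; split => // i j _ _; exact: ei.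
have part (g : T -> R) k : has_sum g k -> (forall i, 0 <= g i) ->
    (forall i, ~ P i -> g i = 0) -> has_sum (g \o e) k.
  move=> gk g0 gP; apply: esum_has_sum => [i|]; first exact: g0.
  by apply: nneg => //; exact: has_sum_nneg.
have [k [k' [fk fk' lE]]] := has_sum_parts fl; rewrite lE.
have off i : ~ P i -> (if i \in P then f i else 0) = 0.
  by move=> Pi; rewrite ifF//; apply/negbTE/negP; rewrite inE.
have fke : has_sum ((fun i => Num.max (if i \in P then f i else 0) 0) \o e) k.
  apply: part fk _ _ => i; first by rewrite le_max lexx orbT.
  by move=> /off ->; rewrite maxxx.
have fke' : has_sum ((fun i => Num.max (- (if i \in P then f i else 0)) 0) \o e) k'.
  apply: part fk' _ _ => i; first by rewrite le_max lexx orbT.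
  by move=> /off ->; rewrite oppr0 maxxx.
apply: eq_has_sum (has_sumD fke (has_sumN fke')) => i /=.
have -> : e i \in P by rewrite inE -eP; exists i.
by rewrite /Num.max; case: ltP => ?; case: ltP => ?; lra.
Qed.

Lemma has_sumZ (T : choiceType) (f : T -> R) k r :
  has_sum f k -> has_sum (fun i => r * f i) (r * k).
Proof.
have nneg s : 0 <= s -> has_sum f k -> has_sum (fun i => s * f i) (s * k).
  move=> s0 [u [v [U [V [u0 v0 eU eV [fuv ->]]]]]].
  exists (fun i => s * u i), (fun i => s * v i), (s * U), (s * V); split.
  - by move=> i; rewrite mulr_ge0.
  - by move=> i; rewrite mulr_ge0.
  - by under eq_esum do rewrite EFinM; rewrite esumZl ?eU// => i; rewrite lee_fin.
  - by under eq_esum do rewrite EFinM; rewrite esumZl ?eV// => i; rewrite lee_fin.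
  - by split => [i|]; rewrite ?fuv mulrBr.
have [/nneg//|r0 fk] := leP 0 r.
have := has_sumN (nneg (- r) _ fk); rewrite mulNr opprK oppr_ge0 (ltW r0).
by move=> /(_ isT); apply: eq_has_sum => i; rewrite mulNr opprK.
Qed.

Lemma has_sum_sum (T : choiceType) (I : finType) (f : I -> T -> R) (k : I -> R) :
  (forall c, has_sum (f c) (k c)) ->
  has_sum (fun i => \sum_c f c i) (\sum_c k c).
Proof.
move=> fk; elim: (index_enum I) => [|c r IH].
  by rewrite big_nil; apply: eq_has_sum has_sum0 => i; rewrite big_nil.
rewrite big_cons; apply: eq_has_sum (has_sumD (fk c) IH) => i.
by rewrite big_cons.
Qed.

Lemma has_sum_abs (T : choiceType) (f : T -> R) k :
  has_sum f k -> exists l, has_sum (fun i => `|f i|) l.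
Proof.
move=> /has_sum_parts[u [v [fu fv _]]]; exists (u + v).
apply: eq_has_sum (has_sumD fu fv) => i.
rewrite /Num.max; case: ltP => f0; case: ltP => ?.
- lra.
- by rewrite ltr0_norm// add0r.
- by rewrite ger0_norm// addr0.
- by rewrite ger0_norm//; lra.
Qed.

Lemma has_sum_bij (S T : choiceType) (e : S -> T) (f : T -> R) k :
  bijective e -> has_sum f k -> has_sum (f \o e) k.
Proof.
move=> be fk; apply: (@has_sum_reindex _ _ e setT) => //.
- exact: bij_inj.
- by have [e' _ ee'] := be; apply/seteqP; split => // t _; exists (e' t).
- by apply: eq_has_sum fk => i; rewrite in_setT.
Qed.

Lemma has_sum_ge_term (T : choiceType) (f : T -> R) k t :
  (forall i, 0 <= f i) -> has_sum f k -> f t <= k.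
Proof.
move=> f0 /(has_sum_nneg f0) fk; rewrite -lee_fin -fk.
apply: esum_ge; exists [set t]; last by rewrite fsbig_set1.
by split => //; exact: finite_set1.
Qed.

Lemma has_sum_unit (T : choiceType) (t : T) (f : T -> R) :
  (forall i, i = t) -> 0 <= f t -> has_sum f (f t).
Proof.
move=> tE ft; apply: esum_has_sum => [i|]; first by rewrite (tE i).
rewrite (_ : setT = [set t]) ?esum_set1 ?lee_fin//.
by apply/seteqP; split => i _ //=; exact: tE.
Qed.

Lemma has_sum_pow_nat : has_sum (fun m : nat => 2^-1 ^+ m : R) 2.
Proof.
apply: esum_has_sum => [m|]; first by rewrite exprn_ge0// invr_ge0.
rewrite -nneseries_esumT => [|m]; last by rewrite lee_fin exprn_ge0// invr_ge0.
have geo : series (fun m => 2^-1 ^+ m : R) @ \oo --> (2 : R).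
  have := @cvg_geometric_series R 1 2^-1.
  rewrite ger0_norm ?invr_ge0// invf_lt1 ?ltr1n// => /(_ isT).
  rewrite (_ : 1 * _ = 2); last by field.
  by rewrite (_ : geometric 1 2^-1 = (fun m => 2^-1 ^+ m))//; apply/funext => m;
    rewrite /geometric/= mul1r.
rewrite (_ : (fun m => _) = EFin \o series (fun m => 2^-1 ^+ m : R)).
  by rewrite EFin_lim; [rewrite (cvg_lim _ geo)|exact: cvgP geo].
by apply/funext => m /=; rewrite -sumEFin.
Qed.

End HasSum.

(** * Sums over integer vectors *)

Section IntVectors.
Context {R : realType}.

Definition norm1 {n : nat} (w : 'rV[R]_n) : R := \sum_i `|w ord0 i|.

(** Sign and absolute value embed the integers into [bool * nat], where the family is a product of a
    two-term sum and a geometric series. *)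
Lemma has_sum_pow_int : exists k, has_sum (fun m : int => 2^-1 ^+ `|m|%N : R) k.
Proof.
have := has_sum_pow_nat (R := R).
have : has_sum (fun b : bool => 1 : R) 2.
  apply: esum_has_sum => //; rewrite esum_fset//; last exact: finite_finset.
  rewrite (_ : setT = [set` [fset true; false]%fset]); last first.
    by apply/seteqP; split => -[] //= _; rewrite !inE.
  by rewrite fsbig_finite ?set_fsetK//= big_fsetU1 ?inE//= big_seq_fset1.
move=> h1 /(has_sum_mul h1) h2; set e := fun m : int => (m < 0, `|m|%N).
have [|k hk] := has_sum_dominated (f := fun p =>
   if p \in range e then 1 * 2^-1 ^+ p.2 else 0) _ h2.
  move=> p; case: ifP => _; rewrite ?normr0 ?mul1r ?ger0_norm// exprn_ge0//;
  by rewrite invr_ge0.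
exists k; have := has_sum_reindex _ erefl hk => /(_ _)/eq_has_sum; apply.
  by move=> m; exact: mul1r.
by move=> m m' [] /=; lia.
Qed.

(** Induction on [n]: splitting off the first coordinate gives a product family. *)
Lemma has_sum_pow_norm1 n :
  exists k, has_sum (fun z : 'rV[int]_n => \prod_i 2^-1 ^+ `|z ord0 i|%N : R) k.
Proof.
elim: n => [|n [k IH]].
  eexists; apply: (@has_sum_unit _ _ 0); first by move=> z; apply/rowP => -[].
  by rewrite big_ord0.
have [l hl] := has_sum_pow_int.
exists (l * k); set e := fun z : 'rV[int]_(1 + n) => (lsubmx z ord0 ord0, rsubmx z).
have be : bijective e.
  exists (fun p => row_mx p.1%:M p.2) => [z|[a z]]; rewrite /e /=.
    rewrite -[RHS](hsubmxK z); congr row_mx.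
    by apply/matrixP => i j; rewrite !ord1 mxE eqxx mulr1n.
  by rewrite row_mxKl row_mxKr mxE eqxx mulr1n.
apply: eq_has_sum (has_sum_bij be (has_sum_mul hl IH)) => z /=.
rewrite big_ord_recl; congr (_ * _).
  by rewrite mxE; congr (_ ^+ absz (z _ _)); apply/val_inj.
by apply: eq_bigr => i _; rewrite mxE; congr (_ ^+ absz (z _ _)); apply/val_inj.
Qed.

(** The class of [z] modulo 2, with values in a finite type so that the sum over classes is a finite
    sum. *)
Definition parity n (z : 'rV[int]_n) : {ffun 'I_n -> bool} :=
  [ffun i => (2 %| z ord0 i)%Z].

(* (u, v) |-> (u + v, u - v) maps onto the pairs of equal parity, so the double
   sum is a sum of squares indexed by the parity classes. *)
Lemma has_sum_parity_ge0 n (h : 'rV[int]_n -> R) k l :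
  has_sum h k ->
  has_sum (fun p : 'rV[int]_n * 'rV[int]_n => h (p.1 + p.2) * h (p.1 - p.2)) l ->
  0 <= l.
Proof.
have int_inj (a b c d : int) : a + b = c + d -> a - b = c - d -> a = c /\ b = d.
  by lia.
have int_par (a b : int) : (2 %| a - b)%Z = (2 %| a + b)%Z by lia.
have int_half (p q : int) : (2 %| p)%Z = (2 %| q)%Z ->
    ((p + q) %/ 2)%Z + ((p - q) %/ 2)%Z = p /\ ((p + q) %/ 2)%Z - ((p - q) %/ 2)%Z = q.
  by lia.
move=> /has_sum_abs[{}k hk] hl.
pose hc c z := if parity z == c then h z else 0.
have hcs c : exists k, has_sum (hc c) k.
  by apply: has_sum_dominated hk => z; rewrite /hc; case: ifP; rewrite ?normr0.
have [S hS] := choice hcs.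
have := has_sum_sum (fun c => has_sum_mul (hS c) (hS c)).
set e := fun p : 'rV[int]_n * 'rV[int]_n => (p.1 + p.2, p.1 - p.2).
have ei : injective e.
  move=> [a b] [c d] [/= /rowP e1 /rowP e2]; congr pair; apply/rowP => i;
  by have [] := int_inj (a ord0 i) (b ord0 i) (c ord0 i) (d ord0 i);
    move: (e1 i) (e2 i); rewrite !mxE.
move=> /(eq_has_sum (g := fun p => if p \in range e then h p.1 * h p.2 else 0)).
move=> H; have /(has_sum_reindex ei erefl)/has_sum_unique : 
   has_sum (fun p => if p \in range e then h p.1 * h p.2 else 0) (\sum_c S c * S c).
  (* A pair in the range of [e] has both entries in exactly one class [c]. Any other pair has
     entries of different parity, since equal parities would make the half-sum and half-difference
     integral. *)
  apply: H => -[p q] /=; rewrite /hc; case: ifPn => [|/negP].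
    rewrite inE => -[[a b] _ [<- <-]].
    have -> : parity (a - b) = parity (a + b).
      by apply/ffunP => i; rewrite !ffunE !mxE int_par.
    rewrite (bigD1 (parity (a + b)))//= eqxx big1 ?addr0// => c.
    by rewrite eq_sym => /negbTE ->; rewrite mul0r.
  rewrite inE => npq; rewrite big1// => c _.
  case: ifPn; rewrite ?mul0r// => /eqP pc; case: ifPn; rewrite ?mulr0// => /eqP qc.
  case: npq; exists (\row_i ((p ord0 i + q ord0 i) %/ 2)%Z,
                     \row_i ((p ord0 i - q ord0 i) %/ 2)%Z) => //=.
  have pq i : (2 %| p ord0 i)%Z = (2 %| q ord0 i)%Z.
    move: (congr1 (fun f : {ffun _ -> _} => f i) (etrans pc (esym qc))).
    by rewrite !ffunE.
  by rewrite /e/=; congr pair; apply/rowP => i; rewrite !mxE;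
    have [] := int_half _ _ (pq i).
by move=> /(_ _ hl) <-; apply: sumr_ge0 => c _; rewrite -expr2 sqr_ge0.
Qed.

End IntVectors.

(** * Termwise differentiation *)

Section TermwiseDiff.
Context {R : realType}.

(** Summing the termwise bounds leaves a remainder of at most [k] times the square of the norm of
    [h], which is o(h). *)
Lemma termwise_differentiable (V : normedModType R) (T : choiceType)
    (phi : T -> V -> R) (G : V -> R) (x : V) (dphi : T -> V -> R)
    (D : {linear V -> R}) (M : T -> R) (k delta : R) :
  0 < delta -> continuous D ->
  (forall h, `|h| < delta -> has_sum (phi^~ (h + x)) (G (h + x))) ->
  (forall h, has_sum (dphi^~ h) (D h)) ->
  has_sum M k ->
  (forall z h, `|h| < delta ->
     `|phi z (h + x) - (phi z x + dphi z h)| <= `|h| ^+ 2 * M z) ->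
  differentiable G x /\ 'd G x = D :> (V -> R).
Proof.
move=> delta0 cD hG hD hM bound.
have rem h : `|h| < delta -> `|G (h + x) - (G x + D h)| <= `|h| ^+ 2 * k.
  move=> hdelta.
  have hG0 : has_sum (phi^~ x) (G x).
    by have := hG 0; rewrite normr0 add0r; exact.
  have := has_sumD (hG _ hdelta) (has_sumN (has_sumD hG0 (hD h))) => /= hr.
  have hb := has_sumZ (`|h| ^+ 2) hM.
  rewrite ler_norml; apply/andP; split; last first.
    apply: has_sum_le hr hb => z; exact: le_trans (ler_norm _) (bound _ _ hdelta).
  apply: has_sum_le (has_sumN hb) hr => z.
  by have := bound z _ hdelta; rewrite ler_norml => /andP[].
have oG : G \o shift x = cst (G x) + D +o_ 0 id.
  apply/eqaddoP => e e0; near=> h.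
  have hdelta : `|h| < delta.
    by near: h; apply/nbhs0P; near do rewrite add0r; exact: nbhs0_lt.
  apply: le_trans (rem h hdelta) _.
  rewrite expr2 -mulrA mulrC ler_wpM2r//.
  (* The added 1 keeps the denominator positive when [k = 0]. *)
  have : `|h| < e / (`|k| + 1).
    by near: h; apply: nbhs0_lt; rewrite divr_gt0// ltr_wpDl.
  rewrite ltr_pdivlMr ?ltr_wpDl// => /ltW; apply: le_trans.
  by rewrite ler_wpM2l// (le_trans (ler_norm k))// lerDl.
have dG := diff_unique cD oG.
by split=> //; apply/diff_locallyP; rewrite dG.
Unshelve. all: by end_near. Qed.

(** [Et] says e^t - 1 <= t e^t, so the remainder is at most t (e^t - 1). For t >= 0 the same bound
    makes this at most t^2 e^t; for t < 0 the bound e^t - 1 >= t makes it at most t^2. *)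
Lemma expR_taylor2 (t : R) : `|expR t - (1 + t)| <= t ^+ 2 * expR `|t|.
Proof.
have t1 := expR_ge1Dx t; rewrite ger0_norm ?subr_ge0//.
have Et : expR t * (1 - t) <= 1.
  rewrite -[leRHS](expR0) -(subrr t) expRD ler_wpM2l ?expR_ge0//.
  exact: expR_ge1Dx.
have e0 := expR_gt0 t.
have [t0|t0] := leP 0 t; first by rewrite ger0_norm//; nra.
have : 1 <= expR `|t| by rewrite -expR0 ler_expR.
nra.
Qed.

End TermwiseDiff.

(** * Gaussian sums over a lattice *)

Section LatticeSums.
Context {R : realType} {n : nat}.
Implicit Types (w h x : 'rV[R]_n) (z : 'rV[int]_n) (c C : R).

Definition sqnorm w : R := \sum_i w ord0 i ^+ 2.

Lemma norm1_ge0 w : 0 <= norm1 w.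
Proof. by apply: sumr_ge0 => i _. Qed.

Lemma sqnorm_ge0 w : 0 <= sqnorm w.
Proof. by apply: sumr_ge0 => i _; rewrite sqr_ge0. Qed.

Lemma ler_norm1D w h : norm1 (w + h) <= norm1 w + norm1 h.
Proof.
by rewrite /norm1 -big_split/=; apply: ler_sum => i _; rewrite mxE ler_normD.
Qed.

Lemma ler_norm1M (m : nat) (a : 'rV[R]_m) (M : 'M[R]_(m, n)) :
  norm1 (a *m M) <= (\sum_i \sum_j `|M i j|) * norm1 a.
Proof.
rewrite mulr_sumr /norm1.
apply: (@le_trans _ _ (\sum_i \sum_j `|a ord0 j| * `|M j i|)).
  apply: ler_sum => i _; rewrite mxE; apply: le_trans (ler_norm_sum _ _ _) _.
  by apply: ler_sum => j _; rewrite normrM.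
rewrite exchange_big/=; apply: ler_sum => i _; rewrite -mulr_sumr mulrC.
rewrite ler_wpM2r// (bigD1 i)//= lerDl; apply: sumr_ge0 => j _.
exact: sumr_ge0.
Qed.

(** Completing the square in each coordinate: (2 c |w_i| - C)^2 >= 0. *)
Lemma gauss_norm1 c C w : 0 < c ->
  - (c * sqnorm w) + C * norm1 w <= n%:R * (C ^+ 2 / (4 * c)).
Proof.
move=> c0; rewrite /sqnorm /norm1 !mulr_sumr -sumrN -big_split/=.
rewrite -[n in n%:R]card_ord -sum1_card natr_sum mulr_suml.
apply: ler_sum => i _; rewrite mul1r ler_pdivlMr ?mulr_gt0//.
rewrite -(real_normK (num_real (w ord0 i))).
have := sqr_ge0 (2 * c * `|w ord0 i| - C); nra.
Qed.

Context (B : 'M[R]_n) (uB : B \in unitmx).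

Definition lat z : 'rV[R]_n := map_mx intr z *m B.

Lemma latD z z' : lat (z + z') = lat z + lat z'.
Proof. by rewrite /lat map_mxD mulmxDl. Qed.

Lemma latB z z' : lat (z - z') = lat z - lat z'.
Proof. by rewrite /lat map_mxB mulmxBl. Qed.

Lemma lat_inj : injective lat.
Proof.
move=> z z' /(congr1 (mulmx^~ (invmx B))); rewrite !mulmxK// => /rowP e.
by apply/rowP => i; have := e i; rewrite !mxE => /intr_inj.
Qed.

(** The term in [C] leaves room for moments and Taylor remainders. [K] bounds the inverse basis, so
    the 1-norm of [z] is at most [K * norm1 (lat z + x)] up to a constant. Applying [gauss_norm1]
    with [C + K] then leaves a factor e^(-|z|_1), which is at most 2^(-|z|_1). *)
Lemma has_sum_gauss c C x : 0 < c -> exists k,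
  has_sum (fun z => expR (- (c * sqnorm (lat z + x)) + C * norm1 (lat z + x))) k.
Proof.
move=> c0; pose K := \sum_i \sum_j `|invmx B i j|.
have K0 : 0 <= K by apply: sumr_ge0 => i _; exact: sumr_ge0.
have [k hk] := @has_sum_pow_norm1 R n.
have := has_sumZ (expR (n%:R * ((C + K) ^+ 2 / (4 * c)) + K * norm1 x)) hk.
apply: has_sum_dominated => z; rewrite ger0_norm ?expR_ge0//.
apply: (@le_trans _ _ (expR (n%:R * ((C + K) ^+ 2 / (4 * c)) + K * norm1 x) *
   expR (- norm1 (map_mx intr z : 'rV[R]_n)))).
  rewrite -expRD ler_expR.
  have := gauss_norm1 (C + K) (lat z + x) c0.
  have : norm1 (map_mx intr z : 'rV[R]_n) <= K * norm1 (lat z).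
    by have := ler_norm1M (lat z) (invmx B); rewrite mulmxK.
  have : K * norm1 (lat z) <= K * (norm1 (lat z + x) + norm1 x).
    rewrite ler_wpM2l//; have := ler_norm1D (lat z + x) (- x).
    rewrite addrK => /le_trans; apply; rewrite lerD2l.
    by apply: ler_sum => i _; rewrite mxE normrN.
  rewrite /K; lra.
rewrite ler_wpM2l ?expR_ge0//.
rewrite /norm1 -sumrN expR_sum; apply: ler_prod => i _; rewrite expR_ge0/= mxE.
rewrite -intr_norm -abszE -pmulrn expRN exprVn lef_pV2 ?posrE ?expR_gt0 ?exprn_gt0//.
rewrite -[X in expR X]mulr1 expRM_natl lerXn2r ?nnegrE ?expR_ge0//.
by have := expR_ge1Dx (1 : R).
Qed.

End LatticeSums.

(** * The theta function of a lattice: derivatives and variance inequality *)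

Section Theta.
Context {R : realType} {n : nat}.
Implicit Types (w h x : 'rV[R]_n) (z : 'rV[int]_n) (c C : R).

Lemma sqnormD w h :
  sqnorm (w + h) = sqnorm w + 2 * (\sum_i w ord0 i * h ord0 i) + sqnorm h.
Proof.
rewrite /sqnorm mulr_sumr -!big_split/=; apply: eq_bigr => i _.
by rewrite mxE; ring.
Qed.

Lemma ler_coord h i : `|h ord0 i| <= `|h|.
Proof. by rewrite [leRHS]mx_normrE; exact: (le_bigmax _ _ (ord0, i)). Qed.

(** The differential of a function with gradient [d]; it is made a bundled linear map for
    [termwise_differentiable]. *)
Definition dotr (d h : 'rV[R]_n) : R := \sum_i h ord0 i * d ord0 i.

Lemma dotr_linear d : linear (dotr d : 'rV[R]_n -> R^o).
Proof.
move=> a u v; rewrite /dotr scaler_sumr -big_split; apply: eq_bigr => i _ /=.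
by rewrite !mxE mulrDl -mulrA.
Qed.

HB.instance Definition _ d :=
  GRing.isLinear.Build R 'rV[R]_n R^o *:%R (dotr d) (@dotr_linear d).

Lemma dotr_continuous d : continuous (dotr d).
Proof.
rewrite (_ : dotr d = \sum_i (fun h : 'rV[R]_n => h ord0 i * d ord0 i)); last first.
  by apply/funext => h; rewrite fct_sumE.
elim/big_ind: _ => [x|f g cf cg x|i _ x].
- exact: cst_continuous.
- exact: continuousD (cf x) (cg x).
- by apply: continuousM; [exact: coord_continuous|exact: cst_continuous].
Qed.

Context (B : 'M[R]_n) (uB : B \in unitmx).
Local Notation lat := (lat B).

Definition gauss c w : R := expR (- (c * sqnorm w)).

Lemma gauss_gt0 c w : 0 < gauss c w. Proof. exact: expR_gt0. Qed.

(** With [c = pi / s ^+ 2] this is rho_s(L + x). Indexing by integer vectors makes the index set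
    independent of [x], as termwise differentiation requires. *)
Definition theta c x : R :=
  fine (\esum_(z in [set: 'rV[int]_n]) (gauss c (lat z + x))%:E).

Lemma has_sum_theta c x : 0 < c ->
  has_sum (fun z => gauss c (lat z + x)) (theta c x).
Proof.
move=> c0; have [k hk] := has_sum_gauss uB 0 x c0.
have : has_sum (fun z => gauss c (lat z + x)) k.
  by apply: eq_has_sum hk => z; rewrite mul0r addr0.
move=> {}hk; rewrite /theta (has_sum_nneg _ hk)// => z.
exact/ltW/gauss_gt0.
Qed.

Lemma theta_gt0 c x : 0 < c -> 0 < theta c x.
Proof.
move=> c0; apply: lt_le_trans (gauss_gt0 c (lat 0 + x)) _.
have g0 z : 0 <= gauss c (lat z + x) by exact/ltW/gauss_gt0.
exact: (has_sum_ge_term 0 g0 (has_sum_theta x c0)).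
Qed.

(** As |w_i| <= e^(norm1 w), the power is at most e^(2 norm1 w), hence the choice [C = 2] in
    [has_sum_gauss]. *)
Lemma has_sum_moment c x i (j : nat) : 0 < c -> (j <= 2)%N -> exists k,
  has_sum (fun z => (lat z + x) ord0 i ^+ j * gauss c (lat z + x)) k.
Proof.
move=> c0 j2; have [k hk] := has_sum_gauss uB 2 x c0.
apply: has_sum_dominated hk => z; set w := lat z + x.
rewrite normrM (ger0_norm (ltW (gauss_gt0 _ _))) expRD mulrC.
rewrite ler_wpM2l ?expR_ge0// normrX expRM_natl.
have E1 : 1 <= expR (norm1 w) by rewrite -expR0 ler_expR norm1_ge0.
have wi : `|w ord0 i| <= expR (norm1 w).
  have : `|w ord0 i| <= norm1 w.
    by rewrite /norm1 (bigD1 i)//= lerDl; apply: sumr_ge0.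
  by have := expR_ge1Dx (norm1 w); lra.
apply: le_trans (lerXn2r j _ _ wi) (ler_weXn2l E1 j2); rewrite nnegrE//.
Qed.

(** The exponent changes by t = - c (2 S + Q) with |t| <= |h| K. By [expR_taylor2] and K <= e^K the
    Taylor remainder is at most |h|^2 e^(3 K), where 3 K = 6 c N + 3 c n. The quadratic part c Q of
    t gives the second term. *)
Lemma gauss_remainder c w h : 0 < c -> `|h| < 1 ->
  `|gauss c (w + h) -
    (gauss c w + - (2 * c) * (\sum_i w ord0 i * h ord0 i) * gauss c w)| <=
  `|h| ^+ 2 * (expR (3 * c * n%:R) * expR (- (c * sqnorm w) + (6 * c) * norm1 w) +
               c * n%:R * gauss c w).
Proof.
move=> c0 h1; set S := \sum_i _; set N := norm1 w; set Q := sqnorm h.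
have h0 : 0 <= `|h| by [].
have N0 : 0 <= N by exact: norm1_ge0.
have Q0 : 0 <= Q by exact: sqnorm_ge0.
have SN : `|S| <= N * `|h|.
  apply: le_trans (ler_norm_sum _ _ _) _; rewrite mulr_suml.
  by apply: ler_sum => i _; rewrite normrM ler_wpM2l// ler_coord.
have Qn : Q <= n%:R * `|h| ^+ 2.
  rewrite -[n in n%:R]card_ord -sum1_card natr_sum mulr_suml.
  apply: ler_sum => i _; rewrite mul1r -(real_normK (num_real (h ord0 i))).
  by rewrite lerXn2r ?nnegrE// ler_coord.
pose t := - (c * (2 * S + Q)); pose K := c * (2 * N + n%:R).
have K0 : 0 <= K by rewrite mulr_ge0 ?addr_ge0 ?mulr_ge0// ltW.
have nh : n%:R * `|h| ^+ 2 <= n%:R * `|h|.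
  by rewrite ler_wpM2l// expr2 ler_piMr// ltW.
have tK : `|t| <= `|h| * K.
  rewrite normrN normrM (gtr0_norm c0) /K mulrCA ler_wpM2l ?(ltW c0)//.
  apply: le_trans (ler_normD _ _) _; rewrite normrM (ger0_norm Q0) ger0_norm//.
  nra.
have -> : gauss c (w + h) = gauss c w * expR t.
  by rewrite /gauss -expRD sqnormD; congr expR; rewrite /t -/S -/Q; ring.
have -> : gauss c w * expR t - (gauss c w + - (2 * c) * S * gauss c w) =
    gauss c w * ((expR t - (1 + t)) - c * Q) by rewrite /t; ring.
rewrite normrM (gtr0_norm (gauss_gt0 _ _)).
have -> : `|h| ^+ 2 * (expR (3 * c * n%:R) * expR (- (c * sqnorm w) + 6 * c * N) +
      c * n%:R * gauss c w) =
    gauss c w * (`|h| ^+ 2 * expR (3 * K) + c * (n%:R * `|h| ^+ 2)).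
  have -> : expR (3 * K) = expR (3 * c * n%:R) * expR (6 * c * N).
    by rewrite -expRD /K; congr expR; ring.
  by rewrite /gauss expRD; ring.
rewrite ler_wpM2l ?expR_ge0//; apply: le_trans (ler_normB _ _) _.
apply: lerD; last first.
  by rewrite ger0_norm ?mulr_ge0 ?(ltW c0)// ler_wpM2l// ltW.
apply: le_trans (expR_taylor2 t) _.
have -> : expR (3 * K) = expR K ^+ 2 * expR K.
  by rewrite -expRM_natl -expRD; congr expR; ring.
rewrite mulrA; apply: ler_pM; rewrite ?sqr_ge0 ?expR_ge0//.
  rewrite -(real_normK (num_real t)) -exprMn lerXn2r ?nnegrE ?mulr_ge0 ?expR_ge0//.
  apply: le_trans tK _; rewrite ler_wpM2l//.
  by apply: le_trans (expR_ge1Dx _); rewrite lerDr.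
rewrite ler_expR; apply: le_trans tK _.
by rewrite ler_piMl// ltW.
Qed.

Lemma theta_differentiable c x (M1 : 'I_n -> R) : 0 < c ->
  (forall i, has_sum (fun z => (lat z + x) ord0 i * gauss c (lat z + x)) (M1 i)) ->
  differentiable (theta c) x /\
  'd (theta c) x = dotr (\row_i (- (2 * c) * M1 i)) :> ('rV[R]_n -> R).
Proof.
move=> c0 hM1.
have [k hk] := has_sum_gauss uB (6 * c) x c0.
have hM := has_sumD (has_sumZ (expR (3 * c * n%:R)) hk)
                    (has_sumZ (c * n%:R) (has_sum_theta x c0)).
pose dphi z h : R :=
  - (2 * c) * (\sum_i (lat z + x) ord0 i * h ord0 i) * gauss c (lat z + x).
apply: (termwise_differentiable (phi := fun z y => gauss c (lat z + y))
  (dphi := dphi) ltr01 _ _ _ hM).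
- exact: dotr_continuous.
- by move=> h _; exact: has_sum_theta.
- move=> h; pose r i := h ord0 i * - (2 * c).
  rewrite [X in has_sum _ X](_ : _ = \sum_i r i * M1 i); last first.
    by apply: eq_bigr => i _; rewrite mxE /r mulrA.
  apply: eq_has_sum (has_sum_sum (fun i => has_sumZ (r i) (hM1 i))) => z.
  by rewrite /dphi /r mulr_sumr mulr_suml; apply: eq_bigr => i _; ring.
- by move=> z h h1; rewrite addrCA addrC; exact: gauss_remainder.
Qed.

(** From q <= (8 / c) e^(c q / 8), the factor q^2 costs e^(c q / 4). As |r| < c / 2, the factor
    e^(|r| q) costs at most e^(c q / 2), so [gauss (c / 4)] remains. *)
Lemma gauss_remainder_param c w r : 0 < c -> `|r| < c / 2 ->
  `|gauss (r + c) w - (gauss c w + r * - (sqnorm w * gauss c w))| <=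
  `|r| ^+ 2 * ((8 / c) ^+ 2 * gauss (c / 4) w).
Proof.
move=> c0 rc; set q := sqnorm w; have q0 : 0 <= q by exact: sqnorm_ge0.
have -> : gauss (r + c) w = gauss c w * expR (- (r * q)).
  by rewrite /gauss -expRD -/q; congr expR; ring.
have -> : gauss c w * expR (- (r * q)) - (gauss c w + r * - (q * gauss c w)) =
    gauss c w * (expR (- (r * q)) - (1 + - (r * q))) by ring.
rewrite normrM (gtr0_norm (gauss_gt0 _ _)).
have := expR_taylor2 (- (r * q)).
rewrite normrN normrM (ger0_norm q0) => /(ler_wpM2l (ltW (gauss_gt0 c w))).
move=> /le_trans; apply.
have -> : gauss c w * ((- (r * q)) ^+ 2 * expR (`|r| * q)) =
    `|r| ^+ 2 * (q ^+ 2 * (expR (`|r| * q) * gauss c w)).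
  by rewrite real_normK ?num_real//; ring.
rewrite ler_wpM2l ?sqr_ge0//.
have qe : q <= 8 / c * expR (c / 8 * q).
  rewrite -ler_pdivrMl ?divr_gt0// invf_div.
  by have := expR_ge1Dx (c / 8 * q); lra.
have -> : gauss (c / 4) w = expR (c / 8 * q) ^+ 2 * expR (- (c / 2 * q)).
  by rewrite -expRM_natl -expRD /gauss -/q; congr expR; field.
rewrite [leRHS]mulrA -exprMn; apply: ler_pM; rewrite ?sqr_ge0 ?mulr_ge0 ?expR_ge0//.
  have c8 : 0 <= 8 / c by rewrite ltW// divr_gt0.
  by rewrite lerXn2r// nnegrE (mulr_ge0 c8)// expR_ge0.
by rewrite /gauss -expRD ler_expR -/q; nra.
Qed.

Lemma theta_is_derive c x (M2 : R) : 0 < c ->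
  has_sum (fun z => sqnorm (lat z + x) * gauss c (lat z + x)) M2 ->
  is_derive c 1 (theta^~ x) (- M2).
Proof.
move=> c0 hM2.
have hM := has_sumZ ((8 / c) ^+ 2) (has_sum_theta x (divr_gt0 c0 (ltr0n _ 4))).
pose dphi z (r : R) : R := r * - (sqnorm (lat z + x) * gauss c (lat z + x)).
have c2 : 0 < c / 2 by rewrite divr_gt0.
(* Here the vector variable is the parameter, with [V := R^o]; the radius [c / 2] keeps [r + c]
   positive. *)
have [||||d1 d2] := (termwise_differentiable (V := R^o)
   (phi := fun z b => gauss b (lat z + x)) (G := theta^~ x) (x := c)
  (dphi := dphi) (D := ( *:%R (- M2) : {linear R^o -> R})) c2 _ _ _ hM).
- exact: scaler_continuous.
- move=> r rc; apply: has_sum_theta; move: rc; rewrite ltr_norml; lra.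
- by move=> r; rewrite [X in has_sum _ X]mulrC; exact: has_sumZ (has_sumN hM2).
- by move=> z r; exact: gauss_remainder_param.
apply: DeriveDef; first exact/derivable1_diffP.
by rewrite deriveE// d2; exact: mulr1.
Qed.

Lemma theta_variance c x i (M1 M2 G2 : R) : 0 < c ->
  has_sum (fun z => (lat z + x) ord0 i * gauss c (lat z + x)) M1 ->
  has_sum (fun z => (lat z + x) ord0 i ^+ 2 * gauss c (lat z + x)) M2 ->
  has_sum (fun z => (lat z + 0) ord0 i ^+ 2 * gauss c (lat z + 0)) G2 ->
  (M1 / theta c x) ^+ 2 <= M2 / theta c x - G2 / theta c 0.
Proof.
move=> c0 hM1 hM2 hG2.
have c2 : 0 < c / 2 by rewrite divr_gt0.
have hM0 := has_sum_theta x c0; have hG0 := has_sum_theta 0 c0.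
have M0 := theta_gt0 x c0; have G0 := theta_gt0 0 c0.
set a := - (M1 / theta c x).
(* If [c = pi / s ^+ 2], the rate [c / 2] belongs to the parameter sqrt 2 s. *)
pose f z := (a + (lat z + x) ord0 i) * gauss (c / 2) (lat z + x).
have [k1 hk1] := has_sum_moment x i c2 (isT : (1 <= 2)%N).
have hf := has_sumD (has_sumZ a (has_sum_theta x c2)) hk1.
have {}hf : has_sum f (a * theta (c / 2) x + k1).
  by apply: eq_has_sum hf => z; rewrite /f expr1; ring.
(* [hl] sums ((a + w_i)^2 - w'_i^2) times both Gaussians over all pairs; the bracket factors as (a +
   w_i + w'_i) (a + w_i - w'_i). *)
have hA := has_sumD (has_sumD (has_sumZ (a ^+ 2) hM0) (has_sumZ (2 * a) hM1)) hM2.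
have hl := has_sumD (has_sum_mul hA hG0) (has_sumN (has_sum_mul hM0 hG2)).
have := has_sum_parity_ge0 hf (eq_has_sum _ hl).
have -> : a ^+ 2 * theta c x + 2 * a * M1 + M2 =
   theta c x * (M2 / theta c x - (M1 / theta c x) ^+ 2).
  by rewrite /a; field; rewrite gt_eqF.
have -> (u v : R) : theta c x * (u - v) * theta c 0 - theta c x * G2 =
   theta c x * theta c 0 * (u - G2 / theta c 0 - v).
  by field; rewrite gt_eqF.
move=> pos; rewrite -subr_ge0 -(pmulr_rge0 _ (mulr_gt0 M0 G0)); apply: pos => -[z z'].
rewrite /f /= latD latB addr0.
set w := lat z + x; set w' := lat z'.
have -> : lat z + w' + x = w + w' by rewrite /w addrAC.
have -> : lat z - w' + x = w - w' by rewrite /w addrAC.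
have gg : gauss (c / 2) (w + w') * gauss (c / 2) (w - w') = gauss c w * gauss c w'.
  rewrite /gauss -!expRD; congr expR.
  (* The parallelogram law. *)
  have -> : sqnorm (w - w') = 2 * sqnorm w + 2 * sqnorm w' - sqnorm (w + w').
    rewrite /sqnorm !mulr_sumr -sumrN -!big_split/=; apply: eq_bigr => j _.
    by rewrite !mxE; ring.
  by field.
rewrite [RHS]mulrACA gg !mxE; ring.
Qed.

End Theta.

(** * The periodic Gaussian as a quotient of theta values *)

Section Gaussian.
Context {R : realType} {n : nat}.

Lemma enorm_sqr (w : 'rV[R]_n) : enorm w ^+ 2 = sqnorm w.
Proof. by rewrite /enorm sqr_sqrtr// sqnorm_ge0. Qed.

Lemma lattice_basis_matrix (L : set 'rV[R]_n) : is_lattice L ->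
  exists2 B : 'M[R]_n, B \in unitmx & L = range (lat B).
Proof.
move=> [b /freeP fb ->]; pose B := \matrix_i tnth b i; exists B.
  rewrite -row_free_unit; apply: inj_row_free => v; rewrite mulmx_sum_row => vB.
  apply/rowP => i; rewrite mxE; apply: (fb (v ord0)); rewrite -[RHS]vB.
  by apply: eq_bigr => j _; rewrite rowK (tnth_nth 0).
have latE (z : 'I_n -> int) : lat B (\row_i z i) = \sum_i tnth b i *~ z i.
  rewrite /lat mulmx_sum_row; apply: eq_bigr => i _.
  by rewrite rowK !mxE scaler_int.
apply/seteqP; split => [w [z _ <-]|w [z _ <-]]; first by exists (\row_i z i).
exists (z ord0) => //; rewrite -latE; congr lat.
by apply/rowP => i; rewrite mxE.
Qed.

Context (B : 'M[R]_n) (uB : B \in unitmx).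
Local Notation L := (range (lat B)).

(** Injectivity of [lat] turns the sum over the set into a sum over integer vectors. *)
Lemma rho_set_translate t y : rho_set t (translate L y) = theta B (pi / t ^+ 2) y.
Proof.
rewrite /rho_set /theta /translate image_comp esum_image; last first.
  by move=> z z' _ _ /= /addIr /(lat_inj uB).
congr fine; apply: eq_esum => z _ /=.
by rewrite /rho /gauss enorm_sqr !mulNr mulrAC.
Qed.

Lemma periodic_gaussianE t y :
  periodic_gaussian L t y = theta B (pi / t ^+ 2) y / theta B (pi / t ^+ 2) 0.
Proof.
rewrite /periodic_gaussian rho_set_translate; congr (_ / _).
rewrite -rho_set_translate; congr rho_set.
by apply/seteqP; split => w; [move=> Lw; exists w|move=> [v Lv <-]]; rewrite ?addr0.
Qed.

(** Chain rule through [pi / t ^+ 2]; the signs of the two derivatives cancel. *)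
Lemma theta_scale_is_derive (s : R) y (M2 : R) : 0 < s ->
  has_sum (fun z => sqnorm (lat B z + y) * gauss (pi / s ^+ 2) (lat B z + y)) M2 ->
  is_derive s 1 (fun t => theta B (pi / t ^+ 2) y) (2 * pi / s ^+ 3 * M2).
Proof.
move=> s0 hM2; have c0 : 0 < pi / s ^+ 2 :> R by rewrite divr_gt0 ?pi_gt0// exprn_gt0.
have d1 := theta_is_derive uB c0 hM2.
have d2 : is_derive s 1 (fun t : R => pi / t ^+ 2) (- (2 * pi / s ^+ 3)).
  have s2 : s ^+ 2 != 0 by rewrite expf_neq0// gt_eqF.
  have dv : is_derive s 1 (fun t : R => (t ^+ 2)^-1) (- (s ^+ 2) ^- 2 *: (2 * s)).
    have dX : is_derive s 1 (fun t : R => t ^+ 2) (2 * s).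
      by apply: is_derive_eq (is_deriveX 2 (is_derive_id s 1)) _; exact: mulr1.
    have eX : derivable (fun t : R => t ^+ 2) s 1 by exact: ex_derive.
    apply: DeriveDef; first exact: derivableV.
    by rewrite deriveV// derive_val.
  apply: is_derive_eq (is_deriveZ pi dv) _; rewrite /GRing.scale/=.
  by field; rewrite gt_eqF.
have := @is_derive1_comp R (theta B ^~ y) (fun t => pi / t ^+ 2) s _ _ d1 d2.
by rewrite mulrNN mulrC.
Qed.

End Gaussian.

(** * Quotient rule and the final inequality *)

Lemma is_derive_div {R : realType} (f g : R -> R) (s df dg : R) : g s != 0 ->
  is_derive s 1 f df -> is_derive s 1 g dg ->
  is_derive s 1 (fun t => f t / g t) ((df - f s / g s * dg) / g s).
Proof.
move=> g0 df_ dg_.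
have dV : is_derive s 1 (fun t => (g t)^-1) (- (g s) ^- 2 *: dg).
  apply: DeriveDef; first by apply: derivableV => //; exact: ex_derive.
  by rewrite deriveV ?derive_val//; exact: ex_derive.
apply: is_derive_eq (is_deriveM df_ dV) _.
by rewrite /GRing.scale/=; field.
Qed.

Theorem proposition4p1 (R : realType) (n : nat) (L : set 'rV[R]_n)
    (hL : is_lattice L) (x : 'rV[R]_n) (s : R) (hs : 0 < s) :
  [/\ derivable (fun t : R => periodic_gaussian L t x) s 1,
      differentiable (periodic_gaussian L s) x
    & derive1 (fun t : R => periodic_gaussian L t x) s / periodic_gaussian L s x
      >= s / (2 * pi) * (enorm (gradient (periodic_gaussian L s) x) ^+ 2
                         / periodic_gaussian L s x ^+ 2)].
Proof.
have [B uB ->] := lattice_basis_matrix hL; set c := pi / s ^+ 2.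
have c0 : 0 < c by rewrite divr_gt0 ?pi_gt0// exprn_gt0.
have moment y i j (j2 : (j <= 2)%N) := has_sum_moment uB y i c0 j2.
have [M1 hM1] := choice (fun i => moment x i 1%N isT).
have [M2 hM2] := choice (fun i => moment x i 2%N isT).
have [G2 hG2] := choice (fun i => moment 0 i 2%N isT).
have sqE y (m : 'I_n -> R) :
    (forall i, has_sum (fun z =>
       (lat B z + y) ord0 i ^+ 2 * gauss c (lat B z + y)) (m i)) ->
    has_sum (fun z => sqnorm (lat B z + y) * gauss c (lat B z + y)) (\sum_i m i).
  by move=> hm; apply: eq_has_sum (has_sum_sum hm) => z; rewrite mulr_suml.
have T0 := theta_gt0 uB x c0; have U0 := theta_gt0 uB 0 c0.
have [dx dxE] := theta_differentiable uB c0 hM1.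
(* The leading factor is the periodic Gaussian itself, so the logarithmic derivative is a difference
   of normalised second moments. *)
have ds : is_derive s 1 (fun t => periodic_gaussian (range (lat B)) t x)
    (theta B c x / theta B c 0 *
      (2 * pi / s ^+ 3 * (\sum_i M2 i / theta B c x - \sum_i G2 i / theta B c 0))).
  have d1 := theta_scale_is_derive uB hs (sqE _ _ hM2).
  have d2 := theta_scale_is_derive uB hs (sqE _ _ hG2).
  (* The two functions agree at every real [t]; at [t = 0] both use the same default value of
     division. *)
  have -> : (fun t => periodic_gaussian (range (lat B)) t x) =
      (fun t => theta B (pi / t ^+ 2) x / theta B (pi / t ^+ 2) 0).
    by apply/funext => t; rewrite periodic_gaussianE.
  apply: is_derive_eq (is_derive_div _ d1 d2) _; rewrite -/c ?gt_eqF//.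
  rewrite -!mulr_suml.
  by field; rewrite !gt_eqF.
have gE : periodic_gaussian (range (lat B)) s = theta B c \* cst (theta B c 0)^-1.
  by apply/funext => y; rewrite periodic_gaussianE.
have dg : differentiable (periodic_gaussian (range (lat B)) s) x.
  by rewrite gE; apply: differentiableM.
split=> //.
(* Only the numerator depends on the point, so coordinate [i] of the gradient is - 2 c M1_i divided
   by the theta value at 0. *)
have gradE : enorm (gradient (periodic_gaussian (range (lat B)) s) x) ^+ 2 =
    (2 * c / theta B c 0) ^+ 2 * \sum_i M1 i ^+ 2.
  rewrite enorm_sqr /sqnorm mulr_sumr; apply: eq_bigr => i _; rewrite mxE.
  have -> : 'D_(delta_mx ord0 i) (periodic_gaussian (range (lat B)) s) x =
     - (2 * c) * M1 i / theta B c 0.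
    rewrite gE deriveM; [|exact: diff_derivable|exact: derivable_cst].
    rewrite derive_cst scaler0 add0r deriveE// dxE /GRing.scale/= mulrC; congr (_ / _).
    rewrite /dotr (bigD1 i)//= !mxE !eqxx mul1r big1 ?addr0// => j ji.
    by rewrite !mxE (negbTE ji) andbF mul0r.
  by rewrite -!exprMn -[LHS]sqrrN; congr (_ ^+ 2); ring.
rewrite derive1E derive_val gradE (periodic_gaussianE uB) -/c.
(* With c = pi / s^2 the constant s / (2 pi) (2 c)^2 equals 2 pi / s^3, the one in the derivative in
   [s]. *)
have -> : s / (2 * pi) * ((2 * c / theta B c 0) ^+ 2 * (\sum_i M1 i ^+ 2) /
     (theta B c x / theta B c 0) ^+ 2) =
   2 * pi / s ^+ 3 * \sum_i (M1 i / theta B c x) ^+ 2.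
  under [in RHS]eq_bigr do rewrite expr_div_n.
  have alg (p a b m : R) : 0 < p -> 0 < a -> 0 < b ->
      s / (2 * p) * ((2 * (p / s ^+ 2) / b) ^+ 2 * m / (a / b) ^+ 2) =
      2 * p / s ^+ 3 * (m / a ^+ 2).
    by move=> p0 a0 b0; field; rewrite !gt_eqF.
  by rewrite -mulr_suml; apply: alg => //; exact: pi_gt0.
(* Cancelling the periodic Gaussian and the common factor 2 pi / s^3 leaves a sum over coordinates,
   compared termwise by [theta_variance]. *)
rewrite [leRHS]mulrAC divff ?mul1r ?mulf_neq0 ?invr_neq0 ?gt_eqF//.
rewrite ler_wpM2l ?divr_ge0 ?mulr_ge0 ?pi_ge0 ?exprn_ge0 ?(ltW hs)//.
rewrite -sumrB; apply: ler_sum => i _.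
apply: (theta_variance uB c0 _ (hM2 i) (hG2 i)).
by apply: eq_has_sum (hM1 i) => z; rewrite expr1.
Qed.
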